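(* Let $n\ge 2$ be a natural number. Every short exact sequence $$0\longrightarrow I\xrightarrow{\ i\ }A\xrightarrow{\ q\ }A/I\longrightarrow 0$$ of $\mathbb{Q}(n-1)$-algebras, with $A$ unital, induces an exact sequence $$K_0^n(I)\xrightarrow{\ i_*\ }K_0^n(A)\xrightarrow{\ q_*\ }K_0^n(A/I)$$ of abelian $n$-potent $K$-theory groups.
   Context: $\mathbb{Q}(n-1)\subset\mathbb{C}$ is the cyclotomic field obtained by adjoining $e^{2\pi i/(n-1)}$ to $\mathbb{Q}$. In the exact sequence, $I$ is a two-sided ideal of $A$, in general without unit. An $n$-potent in a ring $R$ is an element $e$ with $e^n=e$. For a unital ring $R$, let $M_\infty(R)=\bigcup_k M_k(R)$, the direct limit under $a\mapsto \mathrm{diag}(a,0)$, and let $\mathcal{P}^n_\infty(R)$ be the set of $n$-potents in $M_\infty(R)$. For $e,f\in\mathcal{P}^n_\infty(R)$ write $e\sim f$ if, for $k$ large enough that $e,f\in M_k(R)$, there are $a,b\in M_k(R)$ with $e=ab$ and $f=ba$. Let $\mathcal{V}^n(R)$ be the set of equivalence classes, an abelian monoid under $[e]+[f]=[\mathrm{diag}(e,f)]$ with identity $[0]$. The group $K_0^n(R)$ is the Grothendieck completion of $\mathcal{V}^n(R)$. A unital ring homomorphism $\alpha:R\to S$ induces $\alpha_*:K_0^n(R)\to K_0^n(S)$, $[(a_{ij})]\mapsto[(\alpha(a_{ij}))]$. For a nonunital $\mathbb{Q}(n-1)$-algebra $I$, let $I^+=\{(a,\lambda):a\in I,\lambda\in\mathbb{Q}(n-1)\}$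 be its unitization, with componentwise addition and scalar multiplication and product $(a,\lambda)(b,\tau)=(ab+a\tau+b\lambda,\lambda\tau)$. Let $\pi:I^+\to\mathbb{Q}(n-1)$, $\pi(a,\lambda)=\lambda$. Then $K_0^n(I):=\ker\bigl(\pi_*:K_0^n(I^+)\to K_0^n(\mathbb{Q}(n-1))\bigr)$. (For an algebra that already has a unit this kernel is naturally isomorphic to the group defined directly.) The map $i_*:K_0^n(I)\to K_0^n(A)$ is the restriction to $K_0^n(I)$ of the map induced by the unital homomorphism $I^+\to A$, $(a,\lambda)\mapsto i(a)+\lambda 1_A$. *)

(* Defs.v *)
From HB Require Import structures.
From mathcomp Require Import all_boot all_order all_algebra.
From mathcomp Require Import generic_quotient.
From mathcomp Require Import complex.
From mathcomp Require Import boolp reals trigo.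

Set Implicit Arguments.
Unset Strict Implicit.
Unset Printing Implicit Defensive.

Import Order.TTheory GRing.Theory Num.Theory.
Local Open Scope ring_scope.
Local Open Scope quotient_scope.

(* [divring_closed S] says that S is a subfield; since F has characteristic 0,
   every subfield contains the rationals. *)
Definition adjoinQ (F : numFieldType) (x : F) : {pred F} :=
  fun y => `[< forall S : {pred F}, divring_closed S -> x \in S -> y \in S >].

Section AdjoinQ.
Variables (F : numFieldType) (x : F).

Lemma adjoinQP y :
  reflect (forall S : {pred F}, divring_closed S -> x \in S -> y \in S)
          (y \in adjoinQ x).
Proof. exact: asboolP. Qed.

Lemma adjoinQ_gen : x \in adjoinQ x.
Proof. by apply/adjoinQP. Qed.

Lemma adjoinQ_divring_closed : divring_closed (adjoinQ x).
Proof.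
split.
- by apply/adjoinQP => S [].
- move=> u v /adjoinQP hu /adjoinQP hv; apply/adjoinQP => S hS hx.
  by case: (hS) => _ hB _; apply: hB; [apply: hu | apply: hv].
- move=> u v /adjoinQP hu /adjoinQP hv; apply/adjoinQP => S hS hx.
  by case: (hS) => _ _ hD; apply: hD; [apply: hu | apply: hv].
Qed.

HB.instance Definition _ :=
  GRing.isDivringClosed.Build F (adjoinQ x) adjoinQ_divring_closed.

End AdjoinQ.

Section Cyclotomic.
Variables (R : realType) (m : nat).

(* e^(2 pi i / m) *)
Definition zeta : R[i] :=
  Complex (cos (2 * pi / m%:R)) (sin (2 * pi / m%:R)).

Record cyclotomic := Cyclotomic {
  cyclotomic_val :> R[i];
  cyclotomic_valP : cyclotomic_val \in adjoinQ zeta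
}.

HB.instance Definition _ := [isSub for cyclotomic_val].
HB.instance Definition _ := [Choice of cyclotomic by <:].
HB.instance Definition _ := [SubChoice_isSubIntegralDomain of cyclotomic by <:].
HB.instance Definition _ := [SubIntegralDomain_isSubField of cyclotomic by <:].

End Cyclotomic.

Section Grothendieck.
Variable M : nmodType.

Definition groth_rel (x y : M * M) : Prop :=
  exists z : M, x.1 + y.2 + z = y.1 + x.2 + z.

Definition groth_relb (x y : M * M) : bool := `[< groth_rel x y >].

Lemma groth_rel_equiv : equiv_class_of groth_relb.
Proof.
split.
- by move=> x; apply/asboolP; exists 0.
- by move=> x y; apply/asboolP/asboolP => -[z hz]; exists z; rewrite hz.
- move=> y x z; rewrite /groth_relb => /asboolP h1 /asboolP h2; apply/asboolP.
  move: h1 h2 => [u hu] [v hv].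
  exists (y.2 + u + (y.1 + v)).
  rewrite [LHS](AC (2*(2*2)) ((1*3*4)*(5*2*6)))/= hu hv.
  by rewrite [LHS](AC (3*3) ((4*2)*((5*3)*(1*6))))/=.
Qed.

Canonical groth_equiv := EquivRelPack groth_rel_equiv.

Definition groth : Type := {eq_quot groth_equiv}.

HB.instance Definition _ := Choice.on groth.
HB.instance Definition _ := EqQuotient.on groth.

Lemma groth_eqP (x y : M * M) :
  \pi_groth x = \pi_groth y <-> groth_rel x y.
Proof.
by split=> [/eqmodP/asboolP|h]; [|apply/eqmodP/asboolP].
Qed.

Definition groth_zero : groth := \pi_groth (0, 0).
Definition groth_add (x y : groth) : groth :=
  \pi_groth ((repr x).1 + (repr y).1, (repr x).2 + (repr y).2).
Definition groth_opp (x : groth) : groth :=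
  \pi_groth ((repr x).2, (repr x).1).

Lemma groth_repr (x : M * M) : groth_rel (repr (\pi_groth x)) x.
Proof. by apply/groth_eqP; rewrite reprK. Qed.

Lemma groth_addE (x y : M * M) :
  groth_add (\pi_groth x) (\pi_groth y) = \pi_groth (x.1 + y.1, x.2 + y.2).
Proof.
apply/groth_eqP; have [u hu] := groth_repr x; have [v hv] := groth_repr y.
exists (u + v) => /=.
rewrite [LHS](AC ((2*2)*2) ((1*3*5)*(2*4*6)))/= hu hv.
by rewrite [LHS](AC (3*3) ((1*4)*(2*5)*(3*6)))/=.
Qed.

Lemma groth_oppE (x : M * M) :
  groth_opp (\pi_groth x) = \pi_groth (x.2, x.1).
Proof.
apply/groth_eqP; have [u hu] := groth_repr x.
by exists u; rewrite /= [LHS](ACl (2*1*3))/= -hu [LHS](ACl (2*1*3))/=.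
Qed.

Lemma groth_addA : associative groth_add.
Proof.
move=> x y z; rewrite -[x]reprK -[y]reprK -[z]reprK.
move: (repr x) (repr y) (repr z) => a b c.
by rewrite (groth_addE b c) (groth_addE a b) !groth_addE /= !addrA.
Qed.

Lemma groth_addC : commutative groth_add.
Proof.
move=> x y; rewrite -[x]reprK -[y]reprK.
by rewrite !groth_addE [(repr x).1 + _]addrC [(repr x).2 + _]addrC.
Qed.

Lemma groth_add0 : left_id groth_zero groth_add.
Proof.
move=> x; rewrite -[x]reprK; case: (repr x) => x1 x2.
by rewrite groth_addE /= !add0r.
Qed.

Lemma groth_addN : left_inverse groth_zero groth_opp groth_add.
Proof.
move=> x; rewrite -[x]reprK groth_oppE groth_addE; apply/groth_eqP.
by exists 0; rewrite /= !addr0 !add0r addrC.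
Qed.

HB.instance Definition _ := GRing.isZmodule.Build groth
  groth_addA groth_addC groth_add0 groth_addN.

Lemma groth_piD (x y : M * M) :
  \pi_groth x + \pi_groth y = \pi_groth (x.1 + y.1, x.2 + y.2) :> groth.
Proof. exact: groth_addE. Qed.

End Grothendieck.

Section GrothendieckMap.
Variables (M N : nmodType) (f : {additive M -> N}).

Definition groth_map (x : groth M) : groth N :=
  \pi_(groth N) (f (repr x).1, f (repr x).2).

Lemma groth_mapE (x : M * M) :
  groth_map (\pi_(groth M) x) = \pi_(groth N) (f x.1, f x.2).
Proof.
apply/groth_eqP; have [u hu] := groth_repr x.
by exists (f u); rewrite /= -!raddfD hu.
Qed.

Lemma groth_map_nmod_morphism : nmod_morphism groth_map.
Proof.
split; first by rewrite (groth_mapE (0, 0)) /= raddf0.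
move=> x y; rewrite -[x]reprK -[y]reprK.
by rewrite groth_piD !groth_mapE groth_piD /= !raddfD.
Qed.

HB.instance Definition _ := GRing.isNmodMorphism.Build (groth M) (groth N)
  groth_map groth_map_nmod_morphism.

End GrothendieckMap.

Section Npotents.
Variable n : nat.

(* An element of M_k(R) stands for an element of M_oo(R), the sizes k being
   compared only in [npot_sim] below. *)
Definition npotents (R : pzRingType) : Type :=
  {k : nat & {e : 'M[R]_k | e ^+ n == e}}.

HB.instance Definition _ (R : pzRingType) := Choice.on (npotents R).

Definition npot_size (R : pzRingType) (e : npotents R) : nat := tag e.
Definition npot_mx (R : pzRingType) (e : npotents R) : 'M[R]_(npot_size e) :=
  val (tagged e).

Definition Npotent (R : pzRingType) k (e : 'M[R]_k) (he : e ^+ n == e) :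
  npotents R := Tagged (fun k => {e : 'M[R]_k | e ^+ n == e}) (exist _ e he).

(* diag(a, 0) in M_N(R), for k <= N. *)
Definition mxpad (R : pzRingType) N k (a : 'M[R]_k) : 'M[R]_N :=
  \matrix_(i < N, j < N)
    if (insub (val i), insub (val j)) is (Some i', Some j') then a i' j'
    else 0.

Definition npot_sim (R : pzRingType) (e f : npotents R) : Prop :=
  exists N : nat, [/\ (npot_size e <= N)%N, (npot_size f <= N)%N &
    exists a b : 'M[R]_N,
      mxpad N (npot_mx e) = a *m b /\ mxpad N (npot_mx f) = b *m a].

Section Sim.
Variable R : pzRingType.
Implicit Types e f g : npotents R.

Lemma mxpadE N k (a : 'M[R]_k) : (k <= N)%N ->
  mxpad N a = (pid_mx k : 'M_(N, k)) *m a *m (pid_mx k : 'M_(k, N)).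
Proof.
move=> leN; apply/matrixP => i j; rewrite mxE [RHS]mxE.
case: (insubP _ (val j)) => [j' _ ej|nj]; last first.
  rewrite big1 => [|l _]; first by case: insub.
  rewrite [X in _ * X]mxE; case: eqP => [e|]; last by rewrite mulr0.
  by move: nj; rewrite /= -e ltn_ord.
rewrite (bigD1 j') //= big1 ?addr0 => [|l nl]; last first.
  rewrite [X in _ * X]mxE -ej; case: eqP => [/val_inj e|]; last by rewrite mulr0.
  by rewrite e eqxx in nl.
rewrite [X in _ * X]mxE -ej eqxx ltn_ord mulr1 mxE.
case: (insubP _ (val i)) => [i' _ ei|ni]; last first.
  rewrite big1 // => l _.
  rewrite mxE; case: eqP => [e|]; last by rewrite mul0r.
  by move: ni; rewrite /= e ltn_ord.
rewrite (bigD1 i') //= big1 ?addr0 => [|l nl]; last first.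
  rewrite mxE -ei; case: eqP => [/val_inj e|]; last by rewrite mul0r.
  by rewrite e eqxx in nl.
by rewrite mxE -ei eqxx ltn_ord mul1r.
Qed.

Lemma mul_pid_mx_small N k : (k <= N)%N ->
  (pid_mx k : 'M[R]_(k, N)) *m (pid_mx k : 'M_(N, k)) = 1%:M.
Proof.
by move=> leN; rewrite mul_pid_mx minnn (minn_idPr leN) pid_mx_1.
Qed.

Lemma mxexprS k (a : 'M[R]_k) m : a ^+ m.+1 = a *m a ^+ m.
Proof. exact: exprS. Qed.

Lemma mulmx_expr_swap k l (a : 'M[R]_(k, l)) (b : 'M_(l, k)) m :
  (a *m b) ^+ m *m a = a *m (b *m a) ^+ m.
Proof.
elim: m => [|m IHm]; first by rewrite !expr0 mul1mx mulmx1.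
by rewrite !mxexprS -!mulmxA IHm.
Qed.

Lemma mulmx_expr_mid k l (a : 'M[R]_(k, l)) (b : 'M_(l, k)) m :
  b *m (a *m b) ^+ m *m a = (b *m a) ^+ m.+1.
Proof. by rewrite -mulmxA mulmx_expr_swap mulmxA -mxexprS. Qed.

Lemma mxpad_expr N k (a : 'M[R]_k) m : (k <= N)%N ->
  mxpad N a ^+ m.+1 = mxpad N (a ^+ m.+1).
Proof.
move=> leN; rewrite !mxpadE //; elim: m => [|m IHm]; first by rewrite !expr1.
rewrite mxexprS IHm [in RHS]mxexprS.
set P := (pid_mx k : 'M_(N, k)); set Q := (pid_mx k : 'M_(k, N)).
rewrite !mulmxA -[P *m a *m Q *m P]mulmxA.
by rewrite mul_pid_mx_small // mulmx1.
Qed.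

Definition npot_rsim e f : Prop :=
  exists (a : 'M[R]_(npot_size e, npot_size f))
         (b : 'M[R]_(npot_size f, npot_size e)),
    npot_mx e = a *m b /\ npot_mx f = b *m a.

Lemma npot_mxP e : npot_mx e ^+ n = npot_mx e.
Proof. by case: e => k [e he] /=; apply/eqP. Qed.

Hypothesis n_gt1 : (1 < n)%N.

Lemma npot_simE e f : npot_sim e f <-> npot_rsim e f.
Proof.
have [m nE] : exists m, n = m.+2 by case: n n_gt1 => [|[|m]] // _; exists m.
have He := npot_mxP e; have Hf := npot_mxP f; rewrite nE in He Hf.
move: He Hf; rewrite /npot_sim /npot_rsim.
move: (npot_mx e) (npot_mx f); move: (npot_size e) (npot_size f) => k l.
move=> {}e {}f He Hf; split=> [[N [lek lel [a [b [eab fba]]]]]|[a [b [eab fba]]]].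
- pose P := (pid_mx k : 'M[R]_(k, N)); pose Q := (pid_mx k : 'M[R]_(N, k)).
  pose P' := (pid_mx l : 'M[R]_(l, N)); pose Q' := (pid_mx l : 'M[R]_(N, l)).
  have PQ : P *m Q = 1%:M by exact: mul_pid_mx_small.
  have PQ' : P' *m Q' = 1%:M by exact: mul_pid_mx_small.
  have peE j : (a *m b) ^+ j.+1 = Q *m e ^+ j.+1 *m P.
    by rewrite -eab mxpad_expr // mxpadE.
  have pfE j : (b *m a) ^+ j.+1 = Q' *m f ^+ j.+1 *m P'.
    by rewrite -fba mxpad_expr // mxpadE.
  exists (P *m (a *m (b *m a) ^+ m.+1) *m Q'), (P' *m b *m Q); split.
    have -> : P *m (a *m (b *m a) ^+ m.+1) *m Q' *m (P' *m b *m Q)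
            = P *m (a *m (b *m a) ^+ m.+1 *m b) *m Q.
      rewrite pfE -!mulmxA; do 4!congr (_ *m _).
      by rewrite [P' *m (Q' *m _)]mulmxA PQ' mul1mx.
    by rewrite mulmx_expr_mid peE He !mulmxA PQ mul1mx -mulmxA PQ mulmx1.
  have -> : P' *m b *m Q *m (P *m (a *m (b *m a) ^+ m.+1) *m Q')
          = P' *m (b *m (a *m b) ^+ m.+1 *m a) *m Q'.
    rewrite -mulmx_expr_swap peE -!mulmxA; do 2!congr (_ *m _).
    by rewrite [P *m (Q *m _)]mulmxA PQ mul1mx.
  by rewrite mulmx_expr_mid pfE Hf !mulmxA PQ' mul1mx -mulmxA PQ' mulmx1.
- exists (maxn k l); split; [exact: leq_maxl | exact: leq_maxr |].
  set N := maxn k l.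
  have lek : (k <= N)%N by exact: leq_maxl.
  have lel : (l <= N)%N by exact: leq_maxr.
  exists ((pid_mx k : 'M_(N, k)) *m a *m (pid_mx l : 'M_(l, N))),
         ((pid_mx l : 'M_(N, l)) *m b *m (pid_mx k : 'M_(k, N))).
  rewrite !mxpadE // eab fba; split; rewrite -!mulmxA; do 2!congr (_ *m _).
    by rewrite [RHS]mulmxA mul_pid_mx_small // mul1mx.
  by rewrite [RHS]mulmxA mul_pid_mx_small // mul1mx.
Qed.

Definition npot_simb e f : bool := `[< npot_sim e f >].

Lemma npot_sim_equiv : equiv_class_of npot_simb.
Proof.
have [m nE] : exists m, n = m.+2 by case: n n_gt1 => [|[|m]] // _; exists m.
split.
- move=> e; apply/asboolP/npot_simE; exists (npot_mx e), (npot_mx e ^+ m.+1).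
  have He := npot_mxP e; rewrite nE in He.
  by rewrite -[_ *m _]/(_ * _) -[_ *m _]/(_ * _) -exprS -exprSr He.
- move=> e f; apply/asboolP/asboolP => /npot_simE[a [b [eE fE]]];
  by apply/npot_simE; exists b, a.
- move=> f e g; rewrite /npot_simb => /asboolP/npot_simE[a [b [eE fE]]].
  move=> /asboolP/npot_simE[c [d [fE' gE]]]; apply/asboolP/npot_simE.
  have He := npot_mxP e; have Hg := npot_mxP g; rewrite nE in He Hg.
  exists (a *m c), (d *m b *m npot_mx e ^+ m); split.
    rewrite !mulmxA -[a *m c *m d]mulmxA -fE' fE !mulmxA -eE.
    rewrite -[npot_mx e *m a *m b]mulmxA -eE.
    by rewrite -[in LHS]He !exprS mulrA.
  have -> : d *m b *m npot_mx e ^+ m *m (a *m c)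
          = d *m (b *m npot_mx e ^+ m *m a) *m c by rewrite !mulmxA.
  by rewrite eE mulmx_expr_mid -fE fE' mulmx_expr_mid -gE Hg.
Qed.

Lemma npot_diag_proof e f :
  block_mx (npot_mx e) 0 0 (npot_mx f) ^+ n ==
  block_mx (npot_mx e) 0 0 (npot_mx f).
Proof.
have H m : block_mx (npot_mx e) 0 0 (npot_mx f) ^+ m.+1 =
    block_mx (npot_mx e ^+ m.+1) 0 0 (npot_mx f ^+ m.+1).
  elim: m => [|m IHm]; first by rewrite !expr1.
  rewrite mxexprS IHm mulmx_block.
  by rewrite !mul0mx !mulmx0 !addr0 !add0r -!mxexprS.
have := (npot_mxP e, npot_mxP f); case: n n_gt1 => // m _ [He Hf].
by rewrite H He Hf.
Qed.

Definition npot_diag e f : npotents R := Npotent (npot_diag_proof e f).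

Lemma npot0_proof : (0 : 'M[R]_0) ^+ n == 0.
Proof. by rewrite thinmx0 eqxx. Qed.

Definition npot0 : npotents R := Npotent npot0_proof.

Lemma npot_rsim_refl e : npot_rsim e e.
Proof. by apply/npot_simE; case: npot_sim_equiv => + _ _ => /(_ e)/asboolP. Qed.

Lemma npot_rsim_diag e e' f f' : npot_rsim e e' -> npot_rsim f f' ->
  npot_rsim (npot_diag e f) (npot_diag e' f').
Proof.
move=> [a [b [eE eE']]] [c [d [fE fE']]].
exists (block_mx a 0 0 c), (block_mx b 0 0 d).
rewrite /npot_mx /= -!/(npot_mx _) eE eE' fE fE'.
by split; rewrite mulmx_block !mul0mx !mulmx0 !addr0 !add0r.
Qed.

Lemma npot_rsim_diagC e f : npot_rsim (npot_diag e f) (npot_diag f e).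
Proof.
exists (block_mx 0 (npot_mx e) (npot_mx f) 0), (block_mx 0 1%:M 1%:M 0).
rewrite /npot_mx /= -!/(npot_mx _).
by split; rewrite mulmx_block !(mul0mx, mulmx0, mul1mx, mulmx1) !addr0 !add0r.
Qed.

Lemma npot_rsim_diag0 f : npot_rsim (npot_diag npot0 f) f.
Proof.
exists (col_mx 0 (npot_mx f)), (row_mx 0 1%:M).
rewrite /npot_mx /= -!/(npot_mx _); split.
  by rewrite mul_col_row !(mul0mx, mulmx0, mulmx1).
by rewrite mul_row_col mul0mx mul1mx add0r.
Qed.

Lemma npot_rsim_cast e f (E : npot_size e = npot_size f) :
  castmx (E, E) (npot_mx e) = npot_mx f -> npot_rsim e f.
Proof.
case: e f E => k e [l f]; rewrite /npot_size /npot_mx /= => E.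
case: l / E f => f; rewrite castmx_id => /val_inj <-.
exact: npot_rsim_refl.
Qed.

Lemma castmx_block_diagA k l m (e : 'M[R]_k) (f : 'M[R]_l) (g : 'M[R]_m) E :
  castmx (E, E) (block_mx e 0 0 (block_mx f 0 0 g)) =
  block_mx (block_mx e 0 0 f) 0 0 g.
Proof.
rewrite (eq_irrelevance E (addnA k l m)).
have := block_mxAx e 0 0 0 f 0 0 0 g; rewrite /= !row_mx0 !col_mx0 => ->.
by rewrite castmx_comp castmx_id.
Qed.

Lemma npot_rsim_diagA e f g :
  npot_rsim (npot_diag e (npot_diag f g)) (npot_diag (npot_diag e f) g).
Proof.
have E : npot_size (npot_diag e (npot_diag f g)) =
         npot_size (npot_diag (npot_diag e f) g) by exact: addnA.
by apply: (npot_rsim_cast (E := E)); exact: castmx_block_diagA.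
Qed.

End Sim.
End Npotents.

(* [npot_sim] is an equivalence relation only for n >= 2, whence the argument
   [hn] of the quotients below. *)
Section Vmonoid.
Variables (n : nat) (hn : (1 < n)%N) (R : pzRingType).

Canonical npot_equiv := EquivRelPack (npot_sim_equiv R hn).

Definition Vn : Type := {eq_quot npot_equiv}.

HB.instance Definition _ := Choice.on Vn.
HB.instance Definition _ := EqQuotient.on Vn.

Lemma Vn_eqP (e f : npotents n R) :
  \pi_Vn e = \pi_Vn f <-> npot_sim e f.
Proof.
by split=> [/eqmodP/asboolP|h]; [|apply/eqmodP/asboolP].
Qed.

Definition Vn_zero : Vn := \pi_Vn (npot0 n R).
Definition Vn_add (x y : Vn) : Vn := \pi_Vn (npot_diag hn (repr x) (repr y)).

Lemma Vn_repr (e : npotents n R) : npot_rsim (repr (\pi_Vn e)) e.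
Proof. by apply/(npot_simE hn _ _)/Vn_eqP; rewrite reprK. Qed.

Lemma Vn_addE (e f : npotents n R) :
  Vn_add (\pi_Vn e) (\pi_Vn f) = \pi_Vn (npot_diag hn e f).
Proof.
by apply/Vn_eqP/(npot_simE hn _ _)/npot_rsim_diag; exact: Vn_repr.
Qed.

Lemma Vn_addA : associative Vn_add.
Proof.
move=> x y z; rewrite -[x]reprK -[y]reprK -[z]reprK.
move: (repr x) (repr y) (repr z) => e f g.
rewrite (Vn_addE f g) (Vn_addE e f) !Vn_addE.
by apply/Vn_eqP/(npot_simE hn _ _)/npot_rsim_diagA.
Qed.

Lemma Vn_addC : commutative Vn_add.
Proof.
move=> x y; rewrite -[x]reprK -[y]reprK !Vn_addE.
by apply/Vn_eqP/(npot_simE hn _ _)/npot_rsim_diagC.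
Qed.

Lemma Vn_add0 : left_id Vn_zero Vn_add.
Proof.
move=> x; rewrite -[x]reprK Vn_addE.
by apply/Vn_eqP/(npot_simE hn _ _)/npot_rsim_diag0.
Qed.

HB.instance Definition _ := GRing.isNmodule.Build Vn Vn_addA Vn_addC Vn_add0.

Lemma Vn_piD (e f : npotents n R) :
  \pi_Vn e + \pi_Vn f = \pi_Vn (npot_diag hn e f) :> Vn.
Proof. exact: Vn_addE. Qed.

Lemma Vn_pi0 : \pi_Vn (npot0 n R) = 0 :> Vn.
Proof. by []. Qed.

Definition K0 : zmodType := groth Vn.

End Vmonoid.

Section Functoriality.
Variables (n : nat) (hn : (1 < n)%N).
Variables (R S : pzRingType) (alpha : {rmorphism R -> S}).

Lemma npot_map_proof (e : npotents n R) :
  map_mx alpha (npot_mx e) ^+ n == map_mx alpha (npot_mx e).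
Proof. by rewrite -rmorphXn /= npot_mxP. Qed.

Definition npot_map (e : npotents n R) : npotents n S :=
  Npotent (npot_map_proof e).

Definition Vn_map (x : Vn hn R) : Vn hn S :=
  \pi_(Vn hn S) (npot_map (repr x)).

Lemma Vn_mapE (e : npotents n R) :
  Vn_map (\pi_(Vn hn R) e) = \pi_(Vn hn S) (npot_map e).
Proof.
apply/Vn_eqP/(npot_simE hn _ _); have [a [b [eE fE]]] := Vn_repr hn e.
exists (map_mx alpha a), (map_mx alpha b).
by rewrite -!map_mxM -eE -fE.
Qed.

Lemma Vn_map_nmod_morphism : nmod_morphism Vn_map.
Proof.
split.
  rewrite -Vn_pi0 -[RHS]Vn_pi0 Vn_mapE; apply/Vn_eqP/(npot_simE hn _ _).
  by exists 0, 0; split; apply/matrixP; case.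
move=> x y; rewrite -[x]reprK -[y]reprK Vn_piD !Vn_mapE Vn_piD.
move: (repr x) (repr y) => e f; congr (\pi_(Vn hn S) _).
apply: (congr1 (Tagged _)); apply: val_inj => /=.
by rewrite /npot_mx /= map_block_mx !map_mx0.
Qed.

HB.instance Definition _ := GRing.isNmodMorphism.Build (Vn hn R) (Vn hn S)
  Vn_map Vn_map_nmod_morphism.

Definition K0_map : {additive K0 hn R -> K0 hn S} :=
  groth_map Vn_map.

End Functoriality.

(* The library's [algType] excludes the zero ring, which must be allowed for
   unital algebras here (A/I is zero when I = A). A join of [PzRing] and
   [Lmodule] cannot be inserted below [Lalgebra] after the fact, so the scalar
   multiplication is part of the mixin. *)
HB.mixin Record PzRing_isPzAlgebra (K : pzRingType) A of GRing.PzRing A := {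
  pzscale : K -> A -> A;
  pzscalerA : forall (k l : K) (x : A),
    pzscale k (pzscale l x) = pzscale (k * l) x;
  pzscale1r : forall x : A, pzscale 1 x = x;
  pzscalerDr : forall (k : K) (x y : A),
    pzscale k (x + y) = pzscale k x + pzscale k y;
  pzscalerDl : forall (x : A) (k l : K),
    pzscale (k + l) x = pzscale k x + pzscale l x;
  pzscalerAl : forall (k : K) (x y : A), pzscale k (x * y) = pzscale k x * y;
  pzscalerAr : forall (k : K) (x y : A), pzscale k (x * y) = x * pzscale k y
}.

#[short(type="pzAlgType")]
HB.structure Definition PzAlgebra (K : pzRingType) :=
  {A of GRing.PzRing A & PzRing_isPzAlgebra K A}.

(* [Nu]: no unit is required. *)
HB.mixin Record Lmodule_isNuAlgebra (K : pzRingType) I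
    of GRing.Lmodule K I := {
  numul : I -> I -> I;
  numulA : associative numul;
  numulDl : left_distributive numul +%R;
  numulDr : right_distributive numul +%R;
  nuscalerAl : forall (k : K) (x y : I), k *: numul x y = numul (k *: x) y;
  nuscalerAr : forall (k : K) (x y : I), k *: numul x y = numul x (k *: y)
}.

#[short(type="nuAlgType")]
HB.structure Definition NuAlgebra (K : pzRingType) :=
  {I of GRing.Lmodule K I & Lmodule_isNuAlgebra K I}.

HB.mixin Record isPzScalable (K : pzRingType) (A B : pzAlgType K)
    (f : A -> B) := {
  pzalghomZ : forall (k : K) (x : A), f (pzscale k x) = pzscale k (f x)
}.

HB.structure Definition PzAlgHom (K : pzRingType) (A B : pzAlgType K) :=
  {f of @GRing.RMorphism A B f & isPzScalable K A B f}.

HB.mixin Record isNuHom (K : pzRingType) (I : nuAlgType K) (A : pzAlgType K)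
    (f : I -> A) := {
  nuhomZ : forall (k : K) (x : I), f (k *: x) = pzscale k (f x);
  nuhomM : forall x y : I, f (numul x y) = f x * f y
}.

HB.structure Definition NuHom (K : pzRingType) (I : nuAlgType K)
    (A : pzAlgType K) :=
  {f of @Algebra.Additive I A f & isNuHom K I A f}.

Notation "{ 'alghom' A -> B }" := (PzAlgHom.type A B)
  (at level 0, A at level 98, B at level 99) : type_scope.
Notation "{ 'nuhom' I -> A }" := (NuHom.type I A)
  (at level 0, I at level 98, A at level 99) : type_scope.

Definition short_exact (K : pzRingType) (I : nuAlgType K) (A B : pzAlgType K)
    (i : {nuhom I -> A}) (q : {alghom A -> B}) : Prop :=
  [/\ injective i,
      forall a : A, q a = 0 <-> exists x : I, i x = a
    & forall b : B, exists a : A, q a = b].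

Section Unitization.
Variables (K : comPzRingType) (I : nuAlgType K).

Lemma numul0l (x : I) : numul 0 x = 0.
Proof. by apply: (addrI (numul 0 x)); rewrite -numulDl !addr0. Qed.

Lemma numul0r (x : I) : numul x 0 = 0.
Proof. by apply: (addrI (numul x 0)); rewrite -numulDr !addr0. Qed.

Definition unitization : Type := (I * K)%type.

HB.instance Definition _ := GRing.Zmodule.copy unitization (I * K)%type.

Definition unitz_one : unitization := (0, 1).
Definition unitz_mul (x y : unitization) : unitization :=
  (numul x.1 y.1 + y.2 *: x.1 + x.2 *: y.1, x.2 * y.2).
Definition unitz_scale (k : K) (x : unitization) : unitization :=
  (k *: x.1, k * x.2).

Lemma unitz_mulA : associative unitz_mul.
Proof.
move=> [a k] [b l] [c m]; rewrite /unitz_mul /=; congr (_, _); last first.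
  exact: mulrA.
rewrite !numulDl !numulDr !scalerDr !scalerA -!nuscalerAl -!nuscalerAr numulA.
rewrite [LHS](AC (3*1*3) ((1*3*5)*(2*4*6)*7))/=.
by rewrite [m * l]mulrC [m * k]mulrC.
Qed.

Lemma unitz_mul1r : left_id unitz_one unitz_mul.
Proof.
move=> [a k]; rewrite /unitz_mul /= numul0l scaler0 scale1r mul1r.
by rewrite !add0r.
Qed.

Lemma unitz_mulr1 : right_id unitz_one unitz_mul.
Proof.
move=> [a k]; rewrite /unitz_mul /= numul0r scaler0 scale1r mulr1.
by rewrite add0r addr0.
Qed.

Lemma unitz_mulDl : left_distributive unitz_mul +%R.
Proof.
move=> [a k] [b l] [c m]; rewrite /unitz_mul /=; congr (_, _); last first.
  exact: mulrDl.
rewrite numulDl scalerDr scalerDl.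
by rewrite [LHS](AC (2*2*2) (1*3*5*(2*4*6)))/=.
Qed.

Lemma unitz_mulDr : right_distributive unitz_mul +%R.
Proof.
move=> [a k] [b l] [c m]; rewrite /unitz_mul /=; congr (_, _); last first.
  exact: mulrDr.
rewrite numulDr scalerDr scalerDl.
by rewrite [LHS](AC (2*2*2) (1*3*5*(2*4*6)))/=.
Qed.

HB.instance Definition _ := GRing.Zmodule_isPzRing.Build unitization
  unitz_mulA unitz_mul1r unitz_mulr1 unitz_mulDl unitz_mulDr.

Lemma unitz_scalerA (k l : K) (x : unitization) :
  unitz_scale k (unitz_scale l x) = unitz_scale (k * l) x.
Proof. by rewrite /unitz_scale /= scalerA mulrA. Qed.

Lemma unitz_scale1r (x : unitization) : unitz_scale 1 x = x.
Proof. by case: x => a l; rewrite /unitz_scale /= scale1r mul1r. Qed.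

Lemma unitz_scalerDr (k : K) (x y : unitization) :
  unitz_scale k (x + y) = unitz_scale k x + unitz_scale k y.
Proof. by rewrite /unitz_scale /= scalerDr mulrDr. Qed.

Lemma unitz_scalerDl (x : unitization) (k l : K) :
  unitz_scale (k + l) x = unitz_scale k x + unitz_scale l x.
Proof. by rewrite /unitz_scale /= scalerDl mulrDl. Qed.

Lemma unitz_scalerAl (k : K) (x y : unitization) :
  unitz_scale k (x * y) = unitz_scale k x * y.
Proof.
case: x y => [a l] [b m]; rewrite /unitz_scale; congr (_, _) => /=.
  by rewrite !scalerDr !scalerA -nuscalerAl [k * m]mulrC.
by rewrite mulrA.
Qed.

Lemma unitz_scalerAr (k : K) (x y : unitization) :
  unitz_scale k (x * y) = x * unitz_scale k y.
Proof.
case: x y => [a l] [b m]; rewrite /unitz_scale; congr (_, _) => /=.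
  by rewrite !scalerDr !scalerA -nuscalerAr [k * l]mulrC.
by rewrite mulrCA.
Qed.

HB.instance Definition _ := PzRing_isPzAlgebra.Build K unitization
  unitz_scalerA unitz_scale1r unitz_scalerDr unitz_scalerDl
  unitz_scalerAl unitz_scalerAr.

Definition unitz_proj (x : unitization) : K := x.2.

Lemma unitz_proj_zmod_morphism : zmod_morphism unitz_proj.
Proof. by []. Qed.

Lemma unitz_proj_monoid_morphism : monoid_morphism unitz_proj.
Proof. by []. Qed.

HB.instance Definition _ := GRing.isZmodMorphism.Build unitization K
  unitz_proj unitz_proj_zmod_morphism.
HB.instance Definition _ := GRing.isMonoidMorphism.Build unitization K
  unitz_proj unitz_proj_monoid_morphism.

Variables (A : pzAlgType K) (i : {nuhom I -> A}).

Definition unitz_ext (x : unitization) : A := i x.1 + pzscale x.2 1.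

Lemma unitz_ext_nmod_morphism : nmod_morphism unitz_ext.
Proof.
have scale0 : pzscale (0 : K) (1 : A) = 0.
  by apply: (addrI (pzscale (0 : K) 1)); rewrite -pzscalerDl !addr0.
split=> [|x y]; rewrite /unitz_ext /=; first by rewrite raddf0 scale0 addr0.
by rewrite raddfD pzscalerDl addrACA.
Qed.

Lemma unitz_ext_monoid_morphism : monoid_morphism unitz_ext.
Proof.
split=> [|x y]; rewrite /unitz_ext /=; first by rewrite raddf0 add0r pzscale1r.
rewrite !raddfD /= !nuhomZ nuhomM mulrDl !mulrDr -pzscalerAl -!pzscalerAr.
by rewrite !mulr1 mul1r pzscalerA [y.2 * _]mulrC !addrA.
Qed.

HB.instance Definition _ := GRing.isNmodMorphism.Build unitization A
  unitz_ext unitz_ext_nmod_morphism.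
HB.instance Definition _ := GRing.isMonoidMorphism.Build unitization A
  unitz_ext unitz_ext_monoid_morphism.

End Unitization.

Section Kernel.
Variables (U V : zmodType) (f : {additive U -> V}).

Definition additive_ker : {pred U} := fun x => f x == 0.

Lemma additive_ker_zmod_closed : zmod_closed additive_ker.
Proof.
split; first by rewrite unfold_in raddf0.
by move=> x y /eqP fx /eqP fy; rewrite unfold_in raddfB /= fx fy subrr.
Qed.

HB.instance Definition _ := GRing.isZmodClosed.Build U additive_ker
  additive_ker_zmod_closed.

Record kernel := Kernel {
  kernel_val :> U;
  kernel_valP : kernel_val \in additive_ker
}.

HB.instance Definition _ := [isSub for kernel_val].
HB.instance Definition _ := [Choice of kernel by <:].
HB.instance Definition _ := [SubChoice_isSubZmodule of kernel by <:].

End Kernel.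

Section K0nonunital.
Variables (n : nat) (hn : (1 < n)%N) (K : comPzRingType) (I : nuAlgType K).

Definition K0nu : zmodType := kernel (K0_map hn (@unitz_proj K I)).

Definition K0nu_map (A : pzAlgType K) (i : {nuhom I -> A}) :
    {additive K0nu -> K0 hn A} :=
  K0_map hn (unitz_ext i) \o
  (\val : kernel (K0_map hn (@unitz_proj K I)) -> K0 hn (unitization I)).

End K0nonunital.

Definition exact_at (U V W : zmodType) (f : {additive U -> V})
    (g : {additive V -> W}) : Prop :=
  forall y : V, g y = 0 <-> exists x : U, f x = y.

(* Main.v *)
From HB Require Import structures.
Require Import Defs.
From mathcomp Require Import all_boot all_algebra.
From mathcomp Require Import generic_quotient complex.
From mathcomp Require Import reals.

(** The classical proof that [K_0] is half exact goes through: complete to free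
modules, lift a conjugation from [A/I] to [A], and recognise the result as a
matrix over the unitization of [I].  What replaces free modules is a family of
[n]-potents with integer entries, which every ring homomorphism preserves.

- Completion ([npot_complement]).  An [n]-potent [e] is a representation of the
  cyclic group of order [n-1] on the image of the idempotent [e^(n-1)].  As
  [n-1] is invertible, averaging over the group makes this representation a
  direct summand of an induced one, where the generator acts by a cyclic
  permutation of [n-1] blocks.  So each [e] has a complement [g] with [e + g]
  equivalent to a block permutation matrix [cshift].  This stands in for the
  eigenspace decomposition of [e] over the cyclotomic field: the matrices
  [cshift] are already scalar, that is, they come from the base field.

- Lifting ([npot_lift]).  If [q e] is equivalent to [q d], then [e] is
  equivalent to an [n]-potent [g] with [q g = diag (q d, 0)].  The equivalence
  over [A/I] lifts to matrices that are inverse to each other only modulo [I];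
  one extra block corrects the defect.

- Pullback ([unitz_potent_pullback]).  The unitization of [I] is the pullback
  of [A -> A/I <- K], so an [n]-potent over [A] whose image in [A/I] is scalar
  comes from a unique matrix over the unitization, which is again [n]-potent.

Now let [y = [e] - [f]] vanish in [K_0(A/I)], so that [q e + z = q f + z] for
some class [z].  Adding complements of [f] and of [z] turns [y] into
[[e'] - [d]], with [d] scalar and [q e'] equivalent to [d].  Lifting and
pulling back give a class over the unitization that maps to [[e']] and whose
scalar part is [[d]]; its difference with [[d]] is the required element of
[K_0(I)].  Conversely the composite of the two maps factors through
[I^+ -> K -> A/I], which is zero on the kernel defining [K_0(I)]. *)

Set Implicit Arguments.
Unset Strict Implicit.
Unset Printing Implicit Defensive.

Import GRing.Theory Num.Theory.
Local Open Scope ring_scope.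

(** * Powers of potent elements and invertible integers *)

Section Powers.
Variables (S : pzSemiRingType) (d : nat) (e : S).
Hypothesis he : e ^+ d.+1 = e.

Lemma potent_exprD a q : e ^+ (a.+1 + q * d) = e ^+ a.+1.
Proof.
elim: q => [|q IHq]; first by rewrite mul0n addn0.
have -> : (a.+1 + q.+1 * d = d.+1 + (a + q * d))%N.
  by rewrite mulSn addnCA !addSn addnS.
by rewrite exprD he -exprS -addSn IHq.
Qed.

Lemma potent_expr_modn a b : (0 < a)%N -> (0 < b)%N -> (a = b %[mod d])%N ->
  e ^+ a = e ^+ b.
Proof.
wlog le_ab : a b / (a <= b)%N => [IH a0 b0 ab|].
  by case/orP: (leq_total a b) => le; [apply: IH|apply/esym/IH].
case: a le_ab => // a le_ab _ _ /esym/eqP.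
rewrite eqn_mod_dvd // => /dvdnP[q bE].
by rewrite -(subnKC le_ab) bE potent_exprD.
Qed.

End Powers.

Lemma inv_nat_central (R : pzRingType) (m : nat) (c x : R) :
  c * m%:R = 1 -> c * x = x * c.
Proof.
move=> cm; have mc : m%:R * c = 1 by rewrite -(commr_nat c m).
by rewrite -[LHS]mulr1 -mc !mulrA -(mulrA c x) commr_nat mulrA cm mul1r.
Qed.

(** The analogue of [scalemxAr] for a central scalar in a noncommutative ring. *)
Lemma scalemxAr_comm (R : pzRingType) (c : R) m n p
    (A : 'M[R]_(m, n)) (B : 'M[R]_(n, p)) : (forall x, c * x = x * c) ->
  A *m (c *: B) = c *: (A *m B).
Proof.
move=> cC; apply/matrixP => i j; rewrite !mxE mulr_sumr.
by apply: eq_bigr => l _; rewrite !mxE !mulrA cC.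
Qed.

(** The exponents of [cyc_out] below decrease by one, modulo [d], along the
cyclic successor. *)
Lemma double_sub_modS a d : (a < d)%N ->
  (d.*2 - a = (d.*2 - a.+1 %% d).+1 %[mod d])%N.
Proof.
rewrite leq_eqVlt => /orP[/eqP <-|ad].
  by rewrite modnn subn0 -addnn -addSn modnDr addSnnS addKn.
by rewrite (modn_small ad) subnSK // -addnn ltn_addr // ltnW.
Qed.

(** * Block cyclic permutation matrices *)

Section CyclicShift.
Variables (d k : nat).

Definition cshift (R : pzRingType) : 'M[R]_(\sum_(i < d) k) :=
  \mxblock_(i < d, j < d) ((j == ordS i)%:R%:M : 'M[R]_k).

Lemma val_iter_ordS l (i : 'I_d) : val (iter l (@ordS d) i) = ((i + l) %% d)%N.
Proof.
elim: l => [|l IHl] /=; first by rewrite addn0 modn_small.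
by rewrite IHl -addn1 modnDml addn1 addnS.
Qed.

Lemma iter_ordS_id (i : 'I_d) : iter d (@ordS d) i = i.
Proof. by apply: val_inj; rewrite val_iter_ordS modnDr modn_small. Qed.

Lemma cshiftX R l : cshift R ^+ l.+1 =
  \mxblock_(i < d, j < d) ((j == iter l.+1 (@ordS d) i)%:R%:M : 'M[R]_k).
Proof.
elim: l => [//|l IHl].
rewrite mxexprS IHl mul_mxblock; apply: eq_mxblock => i j.
rewrite (bigD1 (ordS i)) //= eqxx mul1mx big1 ?addr0 => [|h hi].
  by rewrite -iterSr.
by rewrite (negPf hi) raddf0 mul0mx.
Qed.

Lemma cshift_potent R : cshift R ^+ d.+1 = cshift R.
Proof.
rewrite cshiftX; apply: eq_mxblock => i j.
by rewrite iterS iter_ordS_id.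
Qed.

Lemma map_cshift (R S : pzRingType) (f : {rmorphism R -> S}) :
  map_mx f (cshift R) = cshift S.
Proof. by apply/matrixP => i j; rewrite !mxE rmorphMn rmorph_nat. Qed.

Variables (R : pzRingType) (c : R) (f : 'M[R]_k).
Hypotheses (cd : c * d%:R = 1) (hf : f ^+ d.+1 = f).

(** The embedding of the representation [f] of the cyclic group into the induced
one, by [v |-> (f^i v)_i], and the averaging projection back, by
[(v_i)_i |-> c * sum_i f^(-i) v_i].  Adding multiples of [d] to the exponents
keeps them positive, so that both maps factor through the image of the
idempotent [f^d]. *)
Definition cyc_in : 'M[R]_(\sum_(i < d) k, k) := \mxcol_(i < d) f ^+ (d + i).
Definition cyc_out : 'M[R]_(k, \sum_(i < d) k) :=
  \mxrow_(i < d) (c *: f ^+ (d.*2 - i)).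

Lemma cyc_in_shift : cshift R *m cyc_in = cyc_in *m f.
Proof.
rewrite mul_mxblock_mxrow mxcol_mul; apply: eq_mxcol => i.
rewrite (bigD1 (ordS i)) //= eqxx mul1mx big1 ?addr0 => [|h hi]; last first.
  by rewrite (negPf hi) raddf0 mul0mx.
rewrite -[RHS]/(_ * _) -exprSr; apply: (potent_expr_modn hf) => //.
  by rewrite ltn_addr // (leq_ltn_trans _ (ltn_ord i)).
by rewrite modnDmr addnS.
Qed.

Lemma cyc_out_shift : cyc_out *m cshift R = f *m cyc_out.
Proof.
rewrite mul_mxrow_mxblock mul_mxrow; apply: eq_mxrow => j.
rewrite -(ord_predK j); move: (ord_pred j) => {}j.
rewrite (bigD1 j) //= eqxx mulmx1 big1 => [|h hj]; last first.
  by rewrite (inj_eq (@ordS_inj d)) eq_sym (negPf hj) raddf0 mulmx0.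
rewrite addr0 scalemxAr_comm; last by move=> x; exact: inv_nat_central cd.
congr (_ *: _); rewrite -[RHS]/(_ * _) -exprS.
apply: (potent_expr_modn hf) => //.
  by rewrite subn_gt0 -addnn ltn_addr.
exact/double_sub_modS.
Qed.

Lemma cyc_outK : cyc_out *m cyc_in = f ^+ d.
Proof.
rewrite mul_mxrow_mxcol (eq_bigr (fun=> c *: f ^+ d)) => [|i _]; last first.
  rewrite -scalemxAl; congr (_ *: _); rewrite -[_ *m _]/(_ * _) -exprD.
  have -> : (d.*2 - i + (d + i) = d + 2 * d)%N.
    rewrite [(d + i)%N]addnC addnA subnK; first by rewrite mul2n addnC.
    by rewrite -addnn ltnW // ltn_addr.
  have d0 : (0 < d)%N by exact: leq_ltn_trans (ltn_ord i).
  by apply: (potent_expr_modn hf); rewrite ?ltn_addr // addnC modnMDl.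
by rewrite sumr_const card_ord -scaler_nat scalerA -commr_nat cd scale1r.
Qed.

End CyclicShift.

(** * Complements of n-potents *)

Section Complement.
Variables (n : nat) (hn : (1 < n)%N) (R : pzRingType).

Lemma npot_cshift_proof k : cshift n.-1 k R ^+ n == cshift n.-1 k R.
Proof. by case: n hn => // d _; rewrite cshift_potent. Qed.

Definition npot_cshift k : npotents n R := Npotent (npot_cshift_proof k).

Hypothesis n1_unit : exists c : R, c * n.-1%:R = 1.

(** A Maschke argument.  With [r s = f^(n-1)], where [s] and [r] intertwine [f]
and the shift [C], the matrix [t = 1 - s r] commutes with [C], and it projects
onto a complement of the copy of [f].  The complement of [f] is [t C]. *)
Lemma npot_complement (e : npotents n R) :
  exists g : npotents n R,
    npot_rsim (npot_diag hn e g) (npot_cshift (npot_size e)).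
Proof.
have [c cd] := n1_unit.
have he := npot_mxP e; have hp := npot_cshift_proof (npot_size e).
have nE : n = n.-1.+1 by case: n hn.
case: e he hp => k [f hf]; rewrite /npot_mx /npot_size /=.
set C := cshift _ _ _ => he /eqP hC.
set s := cyc_in n.-1 f; set r := cyc_out n.-1 c f.
have {}he : f ^+ n.-1.+1 = f by rewrite -nE.
have rs : r *m s = f ^+ n.-1 := cyc_outK cd he.
have Cs : C *m s = s *m f := cyc_in_shift he.
have rC : r *m C = f *m r := cyc_out_shift cd he.
pose t := 1%:M - s *m r.
have tC : t *m C = C *m t.
  by rewrite mulmxBl mulmxBr mul1mx mulmx1 -mulmxA rC !mulmxA Cs.
have fdf : f ^+ n.-1 *m f = f by rewrite -[LHS]/(_ * _) -exprSr.
have ffd : f *m f ^+ n.-1 = f by rewrite -[LHS]/(_ * _) -exprS.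
have rt : f *m r *m t = 0.
  by rewrite -mulmxA mulmxBr mulmx1 [r *m _]mulmxA rs mulmxBr mulmxA ffd subrr.
have ts : t *m s *m f = 0.
  by rewrite mulmxBl mul1mx -mulmxA rs mulmxBl -!mulmxA fdf subrr.
have rtC : r *m t *m C = 0 by rewrite -mulmxA tC mulmxA rC.
have ttC : t *m t *m C = t *m C.
  by rewrite {1}/t mulmxBl mul1mx mulmxBl -!mulmxA (mulmxA r) rtC mulmx0 subr0.
have tX l : t ^+ l.+1 *m C = t *m C.
  by elim: l => // l IHl; rewrite mxexprS -mulmxA IHl mulmxA.
have tXn : t ^+ n *m C = t *m C by have := tX n.-1; rewrite -nE.
have htC : (t *m C) ^+ n == t *m C.
  by rewrite -[t *m C]/(t * C) exprMn_comm // hC [_ * _]tXn.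
exists (Npotent htC), (col_mx r t), (row_mx (C *m s) (C *m t)).
rewrite /npot_mx /=; split.
  by rewrite mul_col_row Cs -tC !mulmxA rs fdf rtC ts ttC.
have Ctt : C *m (t *m t) = C *m t by rewrite mulmxA -tC -mulmxA -tC mulmxA.
by rewrite mul_row_col -!mulmxA Ctt -mulmxDr addrC subrK mulmx1.
Qed.

End Complement.

(** * Lifting an equivalence along a surjection *)

Lemma mx_choice (T U : Type) (P : T -> U -> Prop) m n (M : 'M[U]_(m, n)) :
  (forall i j, exists x, P x (M i j)) ->
  exists M' : 'M[T]_(m, n), forall i j, P (M' i j) (M i j).
Proof.
move=> ex.
have /fin_all_exists[g gP] :
    forall ij : 'I_m * 'I_n, exists x, P x (M ij.1 ij.2).
  by case=> i j; exact: ex.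
by exists (\matrix_(i, j) g (i, j)) => i j; rewrite mxE; exact: gP (i, j).
Qed.

Lemma map_mx_surj (A B : Type) (q : A -> B) m n (M : 'M[B]_(m, n)) :
  (forall b, exists a, q a = b) -> exists M', map_mx q M' = M.
Proof.
move=> qs; have [i j|M' hM'] := @mx_choice _ _ (fun x y => q x = y) _ _ M.
  exact: qs.
by exists M'; apply/matrixP => i j; rewrite mxE.
Qed.

(** Let [p = e^(n-1)], and let [a], [b] witness the equivalence of [q e] and
[q d].  Lifting [b] and [a], and multiplying by powers of [e], gives [X0] and
[Y0] whose product [Y0 X0] is [p - j] for some [j] in the kernel of [q].  Since
[(p + j)(p - j) + j j = p], the enlarged matrices [X = (X0; j)] and
[Y = ((p + j) Y0, j)] satisfy [Y X = p] exactly, while [q] sends their extra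
blocks to zero.  Then [g = X e Y]. *)
Lemma npot_lift n (hn : (1 < n)%N) (A B : pzRingType) (q : {rmorphism A -> B})
    (e d : npotents n A) :
  (forall b, exists a, q a = b) ->
  npot_rsim (npot_map q e) (npot_map q d) ->
  exists (g : 'M[A]_(npot_size d + npot_size e)) (hg : g ^+ n == g),
    npot_rsim e (Npotent hg) /\
    map_mx q g = block_mx (map_mx q (npot_mx d)) 0 0 0.
Proof.
move=> qs; have he := npot_mxP e; have hd := npot_mxP d; move: he hd.
case: e d => k [e he'] [l [d hd']]; rewrite /npot_rsim /npot_mx /npot_size /=.
move=> he hd [a [b [eab dba]]].
have [m nE] : exists m, n = m.+2 by exists n.-2; case: (n) hn => [|[|]].
have [x qx] := map_mx_surj b qs; have [y qy] := map_mx_surj a qs.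
have peX r s : (0 < r)%N -> (0 < s)%N -> (r = s %[mod m.+1])%N ->
    e ^+ r = e ^+ s.
  by apply: potent_expr_modn; rewrite -nE.
have mulX r s : e ^+ r *m e ^+ s = e ^+ (r + s) by rewrite exprD.
pose p := e ^+ m.+1.
(* On the image of [p], the power [m.+1 + m] of [e] is the inverse of [e]. *)
pose X0 := x *m p; pose Y0 := e ^+ (m.+1 + m) *m y.
have [j jE] : exists j, j = p - Y0 *m X0 by eexists.
have pp : p *m p = p by rewrite mulX; apply: peX; rewrite // modnDl.
have pY : p *m Y0 = Y0.
  by rewrite mulmxA mulX; congr (_ *m _); apply: peX; rewrite // modnDl.
have Xp : X0 *m p = X0 by rewrite -mulmxA pp.
have pj : p *m j = j by rewrite jE mulmxBr pp mulmxA pY.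
have jp : j *m p = j by rewrite jE mulmxBl pp -mulmxA Xp.
pose X := col_mx X0 j; pose Y := row_mx ((p + j) *m Y0) j.
have YX : Y *m X = p.
  have -> : p = (p + j) *m (p - j) + j *m j.
    by rewrite mulmxBr !mulmxDl pp pj jp addrKA addrNK.
  by rewrite mul_row_col -mulmxA jE subKr.
have eYX : e *m Y *m X = e by rewrite -mulmxA YX -[LHS]/(_ * _) -exprS -nE.
have hg : (X *m (e *m Y)) ^+ n == X *m (e *m Y).
  rewrite nE exprSr -[_ * _]/(_ *m _) mulmxA mulmx_expr_swap eYX.
  rewrite -[X *m _ *m _]mulmxA [_ *m (e *m Y)]mulmxA -[_ *m e]/(_ * _) -exprSr.
  by rewrite -nE he.
exists (X *m (e *m Y)), hg; split.
  by exists (e *m Y), X; rewrite /npot_mx /= eYX.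
have qeX r : map_mx q (e ^+ r) = (a *m b) ^+ r by rewrite rmorphXn /= eab.
have qdX r : (b *m a) ^+ r = map_mx q (d ^+ r) by rewrite rmorphXn /= dba.
have pE r : (0 < r)%N -> (a *m b) ^+ (r + m.+1) = (a *m b) ^+ r.
  move=> r0; rewrite -!qeX; congr map_mx.
  by apply: peX; rewrite ?addn_gt0 ?r0 // modnDr.
have mulabX r s : (a *m b) ^+ r *m (a *m b) ^+ s = (a *m b) ^+ (r + s).
  by rewrite exprD.
have mulabXr r : (a *m b) ^+ r *m (a *m b) = (a *m b) ^+ r.+1 by rewrite exprSr.
have mulabSl r : (a *m b) *m (a *m b) ^+ r = (a *m b) ^+ r.+1 by rewrite exprS.
have qX0 : map_mx q X0 = b *m (a *m b) ^+ m.+1 by rewrite map_mxM qx qeX.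
have qY0 : map_mx q Y0 = (a *m b) ^+ (m.+1 + m) *m a by rewrite map_mxM qy qeX.
have qj : map_mx q j = 0.
  rewrite jE map_mxB map_mxM qX0 qY0 qeX !mulmxA -[_ *m a *m b]mulmxA.
  by rewrite mulabXr mulabX -addnS !pE // subrr.
rewrite map_mxM map_col_mx map_mxM map_row_mx map_mxM map_mxD qj qX0 qY0.
rewrite mul_mx_row mulmx0 mul_col_row !(mulmx0, mul0mx); congr block_mx.
rewrite addr0 eab qeX [(_ ^+ _) *m (_ *m a)]mulmxA mulabX.
rewrite [(a *m b) *m _]mulmxA mulabSl mulmxA -[b *m _ *m _]mulmxA mulabX.
rewrite mulmx_expr_mid qdX; congr map_mx.
rewrite -[RHS]hd nE; apply: (potent_expr_modn (d := m.+1)) => //.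
  by rewrite -nE.
by rewrite -!addnS !modnDl.
Qed.

(** * Scalars of a unital algebra *)

Section PzUnit.
Variables (K : pzRingType) (A : pzAlgType K).

Definition pzunit (k : K) : A := pzscale k 1.

Lemma pzunit_zmod_morphism : zmod_morphism pzunit.
Proof.
have D : {morph pzunit : k l / k + l} by move=> k l; exact: pzscalerDl.
move=> k l; apply: (addIr (pzunit l)); by rewrite -D !subrK.
Qed.

Lemma pzunit_monoid_morphism : monoid_morphism pzunit.
Proof.
split=> [|k l]; first exact: pzscale1r.
by rewrite /pzunit -pzscalerAl mul1r pzscalerA.
Qed.

HB.instance Definition _ := GRing.isZmodMorphism.Build K A
  pzunit pzunit_zmod_morphism.
HB.instance Definition _ := GRing.isMonoidMorphism.Build K A
  pzunit pzunit_monoid_morphism.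

End PzUnit.

Lemma alghom_pzunit (K : pzRingType) (A B : pzAlgType K)
    (q : {alghom A -> B}) k :
  q (pzunit A k) = pzunit B k.
Proof. by rewrite /pzunit pzalghomZ rmorph1. Qed.

(** * The unitization as a pullback *)

Section Excision.
Variables (K : comPzRingType) (I : nuAlgType K) (A B : pzAlgType K).
Variables (i : {nuhom I -> A}) (q : {alghom A -> B}).
Hypothesis iq_exact : short_exact i q.

Lemma unitz_ext_pzunit k : unitz_ext i (pzunit (unitization I) k) = pzunit A k.
Proof.
by rewrite /unitz_ext /= scaler0 raddf0 add0r mulr1.
Qed.

Lemma unitz_proj_pzunit k : unitz_proj (pzunit (unitization I) k) = k.
Proof. exact: mulr1. Qed.

Lemma alghom_unitz_ext x : q (unitz_ext i x) = pzunit B (unitz_proj x).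
Proof.
have [_ kq _] := iq_exact.
by rewrite raddfD /= (kq _).2 ?add0r; [exact: alghom_pzunit|exists x.1].
Qed.

(** The extension of [i] to the unitization may fail to be injective, as when the
image of [i] contains the unit of [A]; the scalar part removes the ambiguity. *)
Lemma unitz_ext_proj_inj x y :
  unitz_ext i x = unitz_ext i y -> unitz_proj x = unitz_proj y -> x = y.
Proof.
have [inj_i _ _] := iq_exact.
case: x y => [a k] [b l]; rewrite /unitz_ext /unitz_proj /= => + kl.
by rewrite kl => /addIr/inj_i->.
Qed.

Lemma unitz_pullback a k : q a = pzunit B k ->
  exists x : unitization I, unitz_ext i x = a /\ unitz_proj x = k.
Proof.
have [_ kq _] := iq_exact => qak.
have /kq[x ix] : q (a - pzunit A k) = 0.
  by rewrite raddfB /= alghom_pzunit qak subrr.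
by exists (x, k); rewrite /unitz_ext /= ix subrK.
Qed.

Lemma unitz_mx_inj m (F G : 'M[unitization I]_m) :
  map_mx (unitz_ext i) F = map_mx (unitz_ext i) G ->
  map_mx (@unitz_proj K I) F = map_mx (@unitz_proj K I) G -> F = G.
Proof.
move=> /matrixP e /matrixP p; apply/matrixP => r s.
by have := p r s; have := e r s; rewrite !mxE; exact: unitz_ext_proj_inj.
Qed.

(** The pulled back matrix is [n]-potent because both of its projections are. *)
Lemma unitz_potent_pullback n m (e : 'M[A]_m) (d : 'M[K]_m) :
  e ^+ n = e -> d ^+ n = d -> map_mx q e = map_mx (pzunit B) d ->
  exists F : 'M[unitization I]_m,
    [/\ F ^+ n == F, map_mx (unitz_ext i) F = e
      & map_mx (@unitz_proj K I) F = d].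
Proof.
move=> he hd qe.
have [F hF] : exists F : 'M[unitization I]_m,
    forall r s, unitz_ext i (F r s) = e r s /\ unitz_proj (F r s) = d r s.
  have /= := @mx_choice (unitization I) (A * K)%type
    (fun x ak => unitz_ext i x = ak.1 /\ unitz_proj x = ak.2) m m
    (\matrix_(r, s) (e r s, d r s)).
  case=> [r s|F hF]; last by exists F => r s; have := hF r s; rewrite mxE.
  by rewrite mxE; apply: unitz_pullback; move/matrixP/(_ r s): qe; rewrite !mxE.
have Fe : map_mx (unitz_ext i) F = e.
  by apply/matrixP => r s; rewrite mxE (hF r s).1.
have Fd : map_mx (@unitz_proj K I) F = d.
  by apply/matrixP => r s; rewrite mxE (hF r s).2.
exists F; split=> //; apply/eqP/unitz_mx_inj; rewrite rmorphXn /=.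
  by rewrite Fe.
by rewrite Fd.
Qed.

End Excision.

(** * Classes of n-potents *)

Local Open Scope quotient_scope.

Section Classes.
Variables (n : nat) (hn : (1 < n)%N).

Lemma npot_rsim_class (R : pzRingType) (e f : npotents n R) :
  npot_rsim e f -> \pi_(Vn hn R) e = \pi_(Vn hn R) f.
Proof. by move=> ef; apply/Vn_eqP/(npot_simE hn _ _). Qed.

Lemma npot_eq (R : pzRingType) k (e f : 'M[R]_k) (he : e ^+ n == e)
  (hf : f ^+ n == f) : e = f -> Npotent he = Npotent hf.
Proof. by move=> ef; congr (Tagged _); apply: val_inj. Qed.

Lemma npot_map_cshift (R S : pzRingType) (f : {rmorphism R -> S}) k :
  npot_map f (npot_cshift hn R k) = npot_cshift hn S k.
Proof. exact/npot_eq/map_cshift. Qed.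

Lemma npot_zero_proof (R : pzRingType) k : (0 : 'M[R]_k) ^+ n == 0.
Proof. by rewrite expr0n; case: n hn. Qed.

Definition npot_zero (R : pzRingType) k : npotents n R :=
  Npotent (npot_zero_proof R k).

(** Padding by a zero block leaves the class of an [n]-potent unchanged. *)
Lemma npot_zero_class (R : pzRingType) k : \pi_(Vn hn R) (npot_zero R k) = 0.
Proof.
rewrite -Vn_pi0; apply: npot_rsim_class; exists 0, 0.
by split; rewrite /npot_mx /= mulmx0.
Qed.

Lemma K0_mapE (R S : pzRingType) (f : {rmorphism R -> S}) (u v : Vn hn R) :
  K0_map hn f (\pi_(groth (Vn hn R)) (u, v)) =
  \pi_(groth (Vn hn S)) (Vn_map f u, Vn_map f v).
Proof. exact: groth_mapE. Qed.

Section Square.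
Variables (R S S' T : pzRingType).
Variables (f : {rmorphism R -> S}) (g : {rmorphism S -> T}).
Variables (f' : {rmorphism R -> S'}) (g' : {rmorphism S' -> T}).
Hypothesis gf : forall x, g (f x) = g' (f' x).

Lemma npot_map_square (e : npotents n R) :
  npot_map g (npot_map f e) = npot_map g' (npot_map f' e).
Proof. by apply/npot_eq/matrixP => r s; rewrite !mxE. Qed.

Lemma K0_map_square x :
  K0_map hn g (K0_map hn f x) = K0_map hn g' (K0_map hn f' x).
Proof.
rewrite -[x]reprK; case: (repr x) => u v; rewrite !K0_mapE.
rewrite -[u]reprK -[v]reprK !Vn_mapE.
by congr (\pi_(groth _) (_, _)); rewrite npot_map_square.
Qed.

End Square.

Lemma Vn_complement (R : pzRingType) (v : Vn hn R) :
  (exists c : R, c * n.-1%:R = 1) ->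
  exists w k, v + w = \pi_(Vn hn R) (npot_cshift hn R k).
Proof.
move=> n1; rewrite -[v]reprK; have [g hg] := npot_complement hn n1 (repr v).
exists (\pi_(Vn hn R) g), (npot_size (repr v)).
by rewrite Vn_piD; apply: npot_rsim_class.
Qed.

End Classes.

(** * Half exactness *)

Section HalfExact.
Variables (n : nat) (hn : (1 < n)%N) (K : comPzRingType).
Hypothesis n1_unit : exists c : K, c * n.-1%:R = 1.
Variables (I : nuAlgType K) (A B : pzAlgType K).
Variables (i : {nuhom I -> A}) (q : {alghom A -> B}).
Hypothesis iq_exact : short_exact i q.

Lemma pzunit_n1_unit (R : pzAlgType K) : exists c : R, c * n.-1%:R = 1.
Proof.
have [c cn] := n1_unit; exists (pzunit R c).
by rewrite -(rmorph_nat (pzunit R)) -rmorphM cn rmorph1.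
Qed.

(** The lifting and pullback steps in terms of classes. *)
Lemma Vn_lift_scalar (v : Vn hn A) (d : npotents n K) :
  Vn_map q v = \pi_(Vn hn B) (npot_map (pzunit B) d) ->
  exists u : Vn hn (unitization I),
    Vn_map (unitz_ext i) u = v /\
    Vn_map (@unitz_proj K I) u = \pi_(Vn hn K) d.
Proof.
have [_ _ q_surj] := iq_exact.
rewrite -[v]reprK Vn_mapE; set e := repr v => /Vn_eqP/(npot_simE hn _ _) ed.
have qd : npot_map q (npot_map (pzunit A) d) = npot_map (pzunit B) d.
  by apply/npot_eq/matrixP => r s; rewrite !mxE; exact: alghom_pzunit.
rewrite -qd in ed; have [g [hg [eg qg]]] := npot_lift hn q_surj ed.
pose d0 := npot_diag hn d (npot_zero hn K (npot_size e)).
have qgd0 : map_mx q g = map_mx (pzunit B) (npot_mx d0).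
  rewrite qg /npot_mx /= map_block_mx !map_mx0; congr block_mx.
  by apply/matrixP => r s; rewrite !mxE; exact: alghom_pzunit.
have [F [hF Fg Fd0]] :=
  unitz_potent_pullback iq_exact (eqP hg) (npot_mxP d0) qgd0.
exists (\pi_(Vn hn (unitization I)) (Npotent hF)); rewrite !Vn_mapE; split.
  rewrite (npot_rsim_class hn eg); congr (\pi_(Vn hn A) _); exact: npot_eq.
have -> : npot_map (@unitz_proj K I) (Npotent hF) = d0.
  exact: npot_eq _ (npot_diag_proof hn d (npot_zero hn K (npot_size e))) Fd0.
by rewrite -Vn_piD npot_zero_class addr0.
Qed.

Lemma K0_half_exact : exact_at (K0nu_map hn i) (K0_map hn q).
Proof.
move=> y; split=> [qy0|[[x kx] <-]]; last first.
  rewrite /K0nu_map /=.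
  rewrite (K0_map_square (f' := @unitz_proj K I) (g' := pzunit B)
    (alghom_unitz_ext iq_exact)).
  by move/eqP: kx => /= ->; rewrite raddf0.
rewrite -[y]reprK; move: (repr y) (reprK y) => [v1 v2] yE.
move: qy0; rewrite -yE K0_mapE => /groth_eqP[z /=].
rewrite addr0 add0r => qz.
have [w [k wk]] := Vn_complement v2 (pzunit_n1_unit A).
have [z' [k' zk']] := Vn_complement z (pzunit_n1_unit B).
pose d := npot_diag hn (npot_cshift hn K k) (npot_cshift hn K k').
have dE (R : pzRingType) (f : {rmorphism K -> R}) :
    \pi_(Vn hn R) (npot_map f d) =
    \pi_(Vn hn R) (npot_cshift hn R k) + \pi_(Vn hn R) (npot_cshift hn R k').
  by rewrite -Vn_mapE -Vn_piD raddfD /= !Vn_mapE !npot_map_cshift.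
(* In the Grothendieck group, [v1 - v2] is [s] minus the class of [d]. *)
pose s := v1 + w + \pi_(Vn hn A) (npot_cshift hn A k').
have [u [us ud]] : exists u : Vn hn (unitization I),
    Vn_map (unitz_ext i) u = s /\
    Vn_map (@unitz_proj K I) u = \pi_(Vn hn K) d.
  apply: Vn_lift_scalar; rewrite dE -zk' -(npot_map_cshift hn q) -Vn_mapE -wk.
  rewrite !raddfD /= Vn_mapE npot_map_cshift -zk'.
  rewrite [LHS](AC (2*2) ((1*3)*(2*4)))/= qz.
  by rewrite [LHS](AC (2*2) ((1*3)*(2*4)))/=.
pose dI := npot_map (pzunit (unitization I)) d.
have xK : \pi_(groth (Vn hn (unitization I)))
      (u, \pi_(Vn hn (unitization I)) dI) \in
    additive_ker (K0_map hn (@unitz_proj K I)).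
  apply/eqP; rewrite K0_mapE; apply/groth_eqP; exists 0.
  rewrite /= !addr0 add0r.
  rewrite ud Vn_mapE; congr (\pi_(Vn hn K) _).
  apply: (npot_eq (npot_diag_proof hn _ _)).
  rewrite -[npot_mx dI]/(map_mx (pzunit _) (npot_mx d)) -map_mx_comp.
  rewrite map_mx_id //.
  exact: unitz_proj_pzunit.
exists (Kernel xK); rewrite /K0nu_map /= K0_mapE.
apply/groth_eqP; exists 0 => /=.
rewrite us Vn_mapE !addr0.
have -> : npot_map (unitz_ext i) dI = npot_map (pzunit A) d.
  by apply/npot_eq/matrixP => r c; rewrite !mxE; exact: unitz_ext_pzunit.
rewrite dE -wk /s.
by rewrite [LHS](AC (3*1) (1*(4*2*3)))/=.
Qed.

End HalfExact.

Lemma cyclotomic_n1_unit (R : realType) (m n : nat) : (1 < n)%N ->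
  exists c : cyclotomic R m, c * n.-1%:R = 1.
Proof.
move=> hn; exists (n.-1%:R^-1); rewrite mulVf //.
apply/eqP => /(congr1 (\val : cyclotomic R m -> R[i])).
rewrite rmorph_nat raddf0 => /eqP.
by rewrite pnatr_eq0; case: n hn => [|[|]].
Qed.

Theorem proposition3p12 (R : realType) (n : nat) (hn : (1 < n)%N)
    (I : nuAlgType (cyclotomic R n.-1)) (A B : pzAlgType (cyclotomic R n.-1))
    (i : {nuhom I -> A}) (q : {alghom A -> B}) :
  short_exact i q -> exact_at (K0nu_map hn i) (K0_map hn q).
Proof. exact: K0_half_exact (cyclotomic_n1_unit R n.-1 hn) _ _ _ i q. Qed.
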